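(* Let $\sigma>1$. For $h,\tau>0$ let $M^{(h,\tau,\sigma)}_j:=h^{j^\sigma}j^{\tau j^\sigma}$, $j\in\mathbb{N}$ (with $0^0:=1$), let $\mathcal{M}^\sigma:=\{M^{(\tau,\tau,\sigma)}:\tau>0\}$, and let $\omega^{(\sigma)}:=\omega_{M^{(1,1,\sigma)}}$ be the associated weight function of $M^{(1,1,\sigma)}=(j^{j^\sigma})_{j\in\mathbb{N}}$. Then for every non-empty open $U\subseteq\mathbb{R}^d$, as locally convex vector spaces, $$\mathcal{E}_{\{\mathcal{M}^\sigma\}}(U)=\mathcal{E}_{\{\omega^{(\sigma)}\}}(U),\qquad \mathcal{E}_{(\mathcal{M}^\sigma)}(U)=\mathcal{E}_{(\omega^{(\sigma)})}(U).$$ Moreover, for all $h,h',\tau,\tau'>0$ one has $\omega_{M^{(h,\tau,\sigma)}}\sim\omega_{M^{(h',\tau',\sigma)}}$, and consequently, for all $h,\tau>0$ and every non-empty open $U\subseteq\mathbb{R}^d$, also $\mathcal{E}_{\{\mathcal{M}^\sigma\}}(U)=\mathcal{E}_{\{\omega_{M^{(h,\tau,\sigma)}}\}}(U)$ and $\mathcal{E}_{(\mathcal{M}^\sigma)}(U)=\mathcal{E}_{(\omega_{M^{(h,\tau,\sigma)}})}(U)$ as locally convex vector spaces.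
   Context: $\mathbb{N}=\{0,1,2,\dots\}$. For $M\in\mathbb{R}_{>0}^{\mathbb{N}}$ with $M_0=1$, the associated weight function is $\omega_M(t):=\sup_{j\in\mathbb{N}}\log(t^j/M_j)$ for $t>0$, $\omega_M(0):=0$. Two functions satisfy $\omega\sim\eta$ if $\omega(t)=O(\eta(t))$ and $\eta(t)=O(\omega(t))$ as $t\to+\infty$. For a function $\omega:[0,\infty)\to[0,\infty)$ put $\varphi_\omega(t):=\omega(e^t)$ and $\varphi^*_\omega(s):=\sup_{t\ge 0}(st-\varphi_\omega(t))$ for $s\ge 0$ (Young conjugate). For a sufficiently regular compact $K$ (smooth boundary, $\overline{K^\circ}=K$), $\mathcal{E}(K)$ denotes the smooth functions on $K$, and for $h>0$ $$\|f\|_{\omega,K,h}:=\sup_{\alpha\in\mathbb{N}^d,x\in K}\frac{|f^{(\alpha)}(x)|}{\exp(\frac1h\varphi^*_\omega(h|\alpha|))},\qquad \|f\|_{M,K,h}:=\sup_{\alpha\in\mathbb{N}^d,x\in K}\frac{|f^{(\alpha)}(x)|}{h^{|\alpha|}M_{|\alpha|}},$$ with corresponding Banach spaces $\mathcal{E}_{\omega,h}(K)$, $\mathcal{E}_{M,h}(K)$ of those $f\in\mathcal{E}(K)$ with finite norm. Then $$\mathcal{E}_{\{\omega\}}(U)=\varprojlim_{K\subset\subset U}\varinjlim_{h>0}\mathcal{E}_{\omega,h}(K),\qquad \mathcal{E}_{(\omega)}(U)=\varprojlim_{K\subset\subset U}\varprojlim_{h>0}\mathcal{E}_{\omega,h}(K),$$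 and for a weight matrix $\mathcal{M}=\{M^{(x)}:x>0\}$ (positive sequences, pointwise non-decreasing in $x$) $$\mathcal{E}_{\{\mathcal{M}\}}(U)=\varprojlim_{K\subset\subset U}\varinjlim_{x>0}\varinjlim_{h>0}\mathcal{E}_{M^{(x)},h}(K),\qquad \mathcal{E}_{(\mathcal{M})}(U)=\varprojlim_{K\subset\subset U}\varprojlim_{x>0}\varprojlim_{h>0}\mathcal{E}_{M^{(x)},h}(K).$$ $K\subset\subset U$ means that $K$ is a compact subset of $U$. *)

(* Defs.v *)
From HB Require Import structures.
From mathcomp Require Import all_boot all_order all_algebra.
From mathcomp Require Import all_classical all_reals all_analysis.
From mathcomp Require complex.

Set Implicit Arguments.
Unset Strict Implicit.
Unset Printing Implicit Defensive.

Import Order.TTheory GRing.Theory Num.Theory.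
Import numFieldNormedType.Exports.

Local Open Scope classical_set_scope.
Local Open Scope ring_scope.

(** Weight sequences and weight functions.  All the suprema below are taken in
    [R], where an unbounded set has supremum 0: they have their usual meaning
    as soon as [t ^+ j / M j] is bounded in [j] for every [t] and
    [t = o(omega (expR t))], which holds for the sequences [Mseq]. *)
Section Weights.
Context {R : realType}.
Implicit Types (M : nat -> R) (omega eta : R -> R).

Definition assoc_weight M (t : R) : R :=
  if 0 < t then sup (range (fun j : nat => ln (t ^+ j / M j))) else 0.

(* [omega =O_(+oo) eta]; the [=O_] of the library does not apply to [+oo], which
   is not canonically a [filter_on]. *)
Definition bigO_infty omega eta : Prop :=
  exists2 k : R, 0 < k & \forall t \near +oo, `|omega t| <= k * `|eta t|.

Definition weight_equiv omega eta : Prop :=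
  bigO_infty omega eta /\ bigO_infty eta omega.

Definition phi omega (t : R) : R := omega (expR t).

Definition young omega (s : R) : R :=
  sup [set s * t - phi omega t | t in [set t | 0 <= t]].

(* [powR] satisfies [0 `^ 0 = 1] and [0 `^ x = 0] for [x != 0], so that
   [Mseq sigma h tau 0 = 1] when [sigma > 0]. *)
Definition Mseq (sigma h tau : R) (j : nat) : R :=
  h `^ (j%:R `^ sigma) * j%:R `^ (tau * j%:R `^ sigma).

Definition Mmatrix (sigma tau : R) : nat -> R := Mseq sigma tau tau.

Definition omega_sigma (sigma : R) : R -> R := assoc_weight (Mseq sigma 1 1).

End Weights.

(** Locally convex spaces realised inside an ambient vector space [V]: the
    vector space structure is the one inherited from [V], so that a space is
    given by its carrier and by its open sets, and [=] on [lcspace V] is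
    equality as locally convex spaces. *)
Section LocallyConvexSpaces.
Context {R : realType}.

Record lcspace (V : lmodType R) := LCSpace {
  carrier : set V ;
  opens : set (set V) }.

Definition is_topology (V : lmodType R) (E : set V) (T : set (set V)) : Prop :=
  [/\ T `<=` [set O | O `<=` E], T E,
      forall A B, T A -> T B -> T (A `&` B) &
      forall S : set (set V), S `<=` T -> T (\bigcup_(A in S) A)].

(* In this library a [tvsType] is locally convex by definition. *)
Definition is_lc_topology (V : lmodType R) (E : set V) (T : set (set V)) : Prop :=
  exists (X : tvsType R) (i : {linear X -> V}),
    [/\ injective i, range i = E & T = [set i @` O | O in [set O | open O]]].

Definition normed_space (V : lmodType R) (E : set V) (N : V -> \bar R) :
    lcspace V :=
  let C := [set f | E f /\ (N f < +oo)%E] in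
  LCSpace C
    [set O | O `<=` C /\
       forall f, O f -> exists2 r : R, 0 < r &
         forall g, C g -> (N (g - f)%R < r%:E)%E -> O g].

(* Inductive limit, in the category of locally convex spaces, of a family that
   is directed under continuous inclusions: the union with the finest locally
   convex topology for which all the inclusions are continuous. *)
Definition indlim (V : lmodType R) (I : Type) (D : set I)
    (F : I -> lcspace V) : lcspace V :=
  let C := \bigcup_(i in D) carrier (F i) in
  LCSpace C
    [set O | exists2 T, T O &
       is_lc_topology C T /\
       forall i A, D i -> T A -> opens (F i) (A `&` carrier (F i))].

(* Projective limit with respect to the maps [pi i], realised inside
   [E `<=` V]: the coarsest topology for which all the [pi i] are continuous. *)
Definition projlim (V V' : lmodType R) (E : set V) (I : Type) (D : set I)
    (pi : I -> V -> V') (F : I -> lcspace V') : lcspace V :=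
  let C := [set f | E f /\ forall i, D i -> carrier (F i) (pi i f)] in
  LCSpace C
    (smallest (is_topology C)
       [set O | exists i A,
          [/\ D i, opens (F i) A & O = C `&` (pi i @^-1` A)]]).

(* Projective limit along inclusions: an intersection. *)
Definition projlim_incl (V : lmodType R) (I : Type) (D : set I)
    (F : I -> lcspace V) : lcspace V :=
  projlim [set: V] D (fun _ f => f) F.

End LocallyConvexSpaces.

(** Smooth functions on R^d with values in a Banach space [W]; the scalar cases
    are [W := R^o] and [W := Cplx R] (defined at the end). *)
Section SmoothFunctions.
Context {R : realType} {d : nat} {W : completeNormedModType R}.
Local Notation Rd := 'rV[R]_d.
Implicit Types (f : Rd -> W) (K U : set Rd).

Definition unit_vec (i : 'I_d) : Rd := delta_mx 0 i.

Definition partials (W' : normedModType R) (s : seq 'I_d) (f : Rd -> W') :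
    Rd -> W' :=
  foldr (fun i g x => 'D_(unit_vec i) g x) f s.

Definition smooth_on (W' : normedModType R) U (f : Rd -> W') : Prop :=
  forall (s : seq 'I_d) x, U x ->
    {for x, continuous (partials s f)} /\
    forall i, derivable (partials s f) x (unit_vec i).

Definition mderiv (alpha : {ffun 'I_d -> nat}) f : Rd -> W :=
  partials (flatten [seq nseq (alpha i) i | i <- enum 'I_d]) f.

Definition mdeg (alpha : {ffun 'I_d -> nat}) : nat := (\sum_i alpha i)%N.

Definition boundary K : set Rd := closure K `\` K^°.

(* The boundary is locally a regular level set of a smooth function. *)
Definition smooth_boundary K : Prop :=
  forall p, boundary K p ->
    exists (O : set Rd) (rho : Rd -> R^o),
      [/\ open O, O p, smooth_on O rho,
          exists i, 'D_(unit_vec i) rho p != 0 &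
          boundary K `&` O = [set x | O x /\ rho x = 0]].

Definition regular_compact K : Prop :=
  [/\ K !=set0, compact K, closure (K^°) = K & smooth_boundary K].

(* Functions on [K] (or on [U]) are represented by their extension by 0.
   [f] is smooth on the regular compact set [K] when it is smooth in the
   interior and all its derivatives extend continuously to [K]. *)
Definition smooth_compact K f : Prop :=
  [/\ forall x, ~ K x -> f x = 0,
      {within K, continuous f},
      smooth_on (K^°) f &
      forall alpha x, K x ->
        cvg (mderiv alpha f y @[y --> within (K^°) (nbhs x)])].

Definition smooth_open U f : Prop :=
  (forall x, ~ U x -> f x = 0) /\ smooth_on U f.

Definition mderivK K (alpha : {ffun 'I_d -> nat}) f (x : Rd) : W :=
  lim (mderiv alpha f y @[y --> within (K^°) (nbhs x)]).

(* ||f|| = sup_(alpha, x in K) |f^(alpha)(x)| / w_|alpha| *)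
Definition weighted_norm (w : nat -> R) K f : \bar R :=
  ereal_sup [set (`|mderivK K alpha f x| / w (mdeg alpha))%:E
            | alpha in [set: {ffun 'I_d -> nat}] & x in K].

Definition ultraK (w : nat -> R) K : lcspace (Rd -> W) :=
  normed_space (smooth_compact K) (weighted_norm w K).

Definition ultraK_omega (omega : R -> R) (h : R) K :=
  ultraK (fun n => expR (h^-1 * young omega (h * n%:R))) K.

Definition ultraK_seq (M : nat -> R) (h : R) K :=
  ultraK (fun n => h ^+ n * M n) K.

Definition pos_reals : set R := [set h | 0 < h].

Definition projlim_compacts U (F : set Rd -> lcspace (Rd -> W)) :
    lcspace (Rd -> W) :=
  projlim (smooth_open U) [set K | regular_compact K /\ K `<=` U]
    (fun K f => patch (fun=> 0) K f) F.

Definition Roumieu_omega (omega : R -> R) U :=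
  projlim_compacts U (fun K =>
    indlim pos_reals (fun h => ultraK_omega omega h K)).

Definition Beurling_omega (omega : R -> R) U :=
  projlim_compacts U (fun K =>
    projlim_incl pos_reals (fun h => ultraK_omega omega h K)).

Definition Roumieu_matrix (MM : R -> nat -> R) U :=
  projlim_compacts U (fun K =>
    indlim pos_reals (fun x =>
      indlim pos_reals (fun h => ultraK_seq (MM x) h K))).

Definition Beurling_matrix (MM : R -> nat -> R) U :=
  projlim_compacts U (fun K =>
    projlim_incl pos_reals (fun x =>
      projlim_incl pos_reals (fun h => ultraK_seq (MM x) h K))).

End SmoothFunctions.

Arguments Roumieu_omega {R d} W omega U.
Arguments Beurling_omega {R d} W omega U.
Arguments Roumieu_matrix {R d} W MM U.
Arguments Beurling_matrix {R d} W MM U.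

(** The complex numbers as a real Banach space, with the usual modulus. *)
Section ComplexValues.
Import complex.
Variable R : realType.

Definition Cplx : Type := Rcomplex R.

HB.instance Definition _ := GRing.Lmodule.copy Cplx (Rcomplex R).

Let normC (x : Cplx) : R := Normc.normc x.

Let normCZ (l : R) (x : Cplx) : normC (l *: x) = `|l| * normC x.
Proof.
case: x => a b; rewrite /normC /= !exprMn -mulrDr.
by rewrite sqrtrM ?sqr_ge0// sqrtr_sqr.
Qed.

HB.instance Definition _ := @Lmodule_isNormed.Build R Cplx normC
  (@le_normcD R) normCZ (@Normc.eq0_normc R).

Let ge_Re (x : Cplx) : `|Re x| <= `|x|.
Proof.
case: x => a b; rewrite -sqrtr_sqr /Num.norm /= /normC /=.
by rewrite ler_wsqrtr// lerDl sqr_ge0.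
Qed.

Let ge_Im (x : Cplx) : `|Im x| <= `|x|.
Proof.
case: x => a b; rewrite -sqrtr_sqr /Num.norm /= /normC /=.
by rewrite ler_wsqrtr// lerDr sqr_ge0.
Qed.

Let le_ReIm (x : Cplx) : `|x| <= `|Re x| + `|Im x|.
Proof.
case: x => a b; rewrite {1}/Num.norm /= /normC /=.
rewrite -[leRHS]ger0_norm ?addr_ge0// -sqrtr_sqr ler_wsqrtr// sqrrD.
by rewrite !real_normK ?num_real// lerD2r lerDl mulrn_wge0// mulr_ge0.
Qed.

Let cauchy_coord (p : Cplx -> R) (F : set_system Cplx) :
    (forall x y, p (x - y) = p x - p y) -> (forall x, `|p x| <= `|x|) ->
  ProperFilter F -> cauchy F -> cvg (p @ F).
Proof.
move=> pB pn FF Fc; apply: cauchy_cvg; apply: cauchy_exP => e e0.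
have /cauchyP/(_ _ e0)[z Fz] := Fc.
exists (p z); rewrite /= /fmap/=.
have sub : ball z e `<=` p @^-1` ball (p z) e.
  move=> y; rewrite -!ball_normE /ball_/= => zy.
  by rewrite -pB (le_lt_trans (pn _)).
exact: (filterS sub).
Qed.

Let Cplx_complete (F : set_system Cplx) : ProperFilter F -> cauchy F -> cvg F.
Proof.
move=> FF Fc.
have Re_sub (x y : Cplx) : Re (x - y) = Re x - Re y by case: x; case: y.
have Im_sub (x y : Cplx) : Im (x - y) = Im x - Im y by case: x; case: y.
have /cvg_ex[a Fa] := @cauchy_coord (@Re R) F Re_sub ge_Re FF Fc.
have /cvg_ex[b Fb] := @cauchy_coord (@Im R) F Im_sub ge_Im FF Fc.
apply/cvg_ex; exists (Complex a b : Cplx).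
apply/cvgrPdist_lt => e e0.
have e2 : 0 < e / 2 by rewrite divr_gt0.
have Ha := (@cvgrPdist_lt _ R^o _ _ _ (@Re R) a).1 Fa _ e2.
have Hb := (@cvgrPdist_lt _ R^o _ _ _ (@Im R) b).1 Fb _ e2.
near=> z; rewrite (le_lt_trans (le_ReIm _))// (splitr e) Re_sub Im_sub.
by rewrite ltrD//=; near: z; [exact: Ha|exact: Hb].
Unshelve. all: by end_near. Qed.

HB.instance Definition _ := Uniform_isComplete.Build Cplx Cplx_complete.

End ComplexValues.

(* Main.v *)
(** Write [M^(h,tau)] for [Mseq sigma h tau] and [L n = n^sigma ln n]. Since
    [ln (k^n M^(h,tau)_n)] lies eventually between [tau/2 L n] and [2 tau L n],
    the parameter [tau] scales the logarithm of the matrix weights linearly, and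
    [h], [k] are irrelevant. Let [omega] be the weight function of [M^(h,tau)].
    As [phi_omega^* (s) <= ln M_j] for every integer [j >= s], and testing the
    supremum at [t] of order [s^(sigma-1) ln s] gives the converse,
    [phi_omega^* (y n) / y] is of order [y^(sigma-1) L n], with constants
    independent of [y]. As [sigma > 1], the factors [y^(sigma-1)] and [tau] can
    both be made arbitrarily small or large, so that each family of weights
    absorbs the other one, in both quantifications. Hence the normed spaces over
    a fixed compact set embed continuously into each other in the required way,
    and the limits agree; that the inner inductive limit may be flattened uses
    that the trace of a locally convex topology on a linear subspace is locally
    convex. The estimate of [ln M_j / y] with [j] just above [y n] also compares
    the weight functions themselves. *)

From HB Require Import structures.
Require Import Defs.
From mathcomp Require Import all_boot all_order all_algebra.
From mathcomp Require Import all_classical all_reals all_analysis.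
From mathcomp Require Import ring lra.

Set Implicit Arguments.
Unset Strict Implicit.
Unset Printing Implicit Defensive.

Import Order.TTheory GRing.Theory Num.Theory.
Import numFieldNormedType.Exports.
Local Open Scope classical_set_scope.
Local Open Scope ring_scope.

(** * Locally convex spaces *)

Section TvsSubspace.
Context {R : realType} {X : tvsType R} {S : {pred X}}.

(* The closure proof is an argument of the type so that the linear structure
   below can be inferred. *)
Definition tvs_subspace of subsemimod_closed S : Type := {x : X | x \in S}.

Variable S_closed : subsemimod_closed S.
Local Notation Y := (tvs_subspace S_closed).

HB.instance Definition _ := SubChoice.on Y.
HB.instance Definition _ :=
  GRing.SubChoice_isSubLmodule.Build R X S Y S_closed.
HB.instance Definition _ := Uniform.copy Y (initial_topology (\val : Y -> X)).

Let val_continuous : continuous (\val : Y -> X).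
Proof. exact: initial_continuous. Qed.

Let continuous_subspace (Z : topologicalType) (f : Z -> Y) :
  continuous (\val \o f) -> continuous f.
Proof. exact: continuous_comp_initial. Qed.

Let subspace_add_continuous : continuous (fun x : Y * Y => x.1 + x.2).
Proof.
apply: continuous_subspace.
have -> : (\val : Y -> X) \o (fun x : Y * Y => x.1 + x.2) =
    (fun x => \val x.1 + \val x.2).
  by apply/funext => x /=; exact: (raddfD (\val : Y -> X)).
move=> x; apply: (@continuous_comp _ _ _ (fun z : Y * Y => (\val z.1, \val z.2))
  (fun z : X * X => z.1 + z.2)); last exact: add_continuous.
by apply: cvg_pair; apply: continuous_comp => //;
  [exact: cvg_fst|exact: val_continuous|exact: cvg_snd|exact: val_continuous].
Qed.

Let subspace_scale_continuous : continuous (fun z : R^o * Y => z.1 *: z.2).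
Proof.
apply: continuous_subspace.
have -> : (\val : Y -> X) \o (fun z : R^o * Y => z.1 *: z.2) =
    (fun z => z.1 *: \val z.2).
  by apply/funext => z /=; exact: (linearZZ (\val : Y -> X)).
move=> x; apply: (@continuous_comp _ _ _ (fun z : R^o * Y => (z.1, \val z.2))
  (fun z : R^o * X => z.1 *: z.2)); last exact: scale_continuous.
apply: (@cvg_pair _ _ _ _ (nbhs (x.1 : R^o))); first exact: cvg_fst.
by apply: continuous_comp; [exact: cvg_snd|exact: val_continuous].
Qed.

Let subspace_locally_convex : exists2 B : set_system Y,
  (forall b, b \in B -> convex_set b) & basis B.
Proof.
have [B Bc [Bo Bb]] := @locally_convex R X.
exists [set \val @^-1` b | b in B].
  move=> _ /set_mem[b Bb' <-] x y l /set_mem/= bx /set_mem/= by_.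
  apply/mem_set => /=.
  have := Bc b (mem_set Bb') (\val x) (\val y) l (mem_set bx) (mem_set by_).
  by move/set_mem.
split=> [_ [b /Bo bo <-]|x A /= [_ [[Q Qo <-] Qx QA]]]; first by exists b.
have [b [Bb' bx] bO] := Bb _ _ (open_nbhs_nbhs (conj Qo Qx)).
by exists (\val @^-1` b); [split=> //; exists b|move=> y /bO/QA].
Qed.

HB.instance Definition _ := PreTopologicalNmodule_isTopologicalNmodule.Build
  Y subspace_add_continuous.
HB.instance Definition _ := TopologicalNmodule_isTopologicalLmodule.Build
  R Y subspace_scale_continuous.
HB.instance Definition _ := Uniform_isTvs.Build R Y subspace_locally_convex.

End TvsSubspace.

(** * Iterated inductive and projective limits *)

Section LocallyConvexLimits.
Context {R : realType} {V : lmodType R}.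
Implicit Types (C : set V) (T : set (set V)) (F G : lcspace V).

(** The points that [i] sends into [C'] form a linear subspace of [X]. With the initial topology of
    its inclusion it is again locally convex, and its open sets are mapped to the traces on [C']. *)
Lemma is_lc_topology_trace C C' T : is_lc_topology C T -> C' `<=` C ->
  C' 0 -> (forall (a : R) f g, C' f -> C' g -> C' (a *: f + g)) ->
  is_lc_topology C' [set A `&` C' | A in T].
Proof.
move=> [X [i [i_inj iC ->]]] C'C C'0 C'lin.
pose S : {pred X} := [pred x | `[< C' (i x) >]].
have Slin : subsemimod_closed S.
  split; first split.
  - by apply/asboolP; rewrite linear0.
  - move=> x y /asboolP Sx /asboolP Sy; apply/asboolP.
    by rewrite linearD -[i x]scale1r; apply: C'lin.
  - move=> a x /asboolP Sx; apply/asboolP.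
    by rewrite linearZZ -[X in C' X]addr0; apply: C'lin.
exists (tvs_subspace Slin), (i \o \val)%FUN; split.
- exact: inj_comp i_inj val_inj.
- apply/seteqP; split => [_ [x _ <-]|f C'f] /=.
    exact/asboolP/(valP x).
  have : range i f by rewrite iC; exact: C'C.
  case=> x _ ixf; have Sx : x \in S by apply/asboolP; rewrite ixf.
  by exists (exist _ x Sx).
- apply/seteqP; split => [_ [_ [B Bo <-] <-]|_ [_ [B Bo <-] <-]].
    exists (\val @^-1` B); first by exists B.
    apply/seteqP; split => [_ [x Ox <-]|_ [[x Ox <-] C'f]].
      by split; [exists (\val x)|exact/asboolP/(valP x)].
    have Sx : x \in S by apply/asboolP.
    by exists (exist _ x Sx).
  exists (i @` B); first by exists B.
  apply/seteqP; split => [_ [[x Ox <-] C'f]|_ [x Ox <-]].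
    have Sx : x \in S by apply/asboolP.
    by exists (exist _ x Sx).
  by split; [exists (\val x)|exact/asboolP/(valP x)].
Qed.

(** Continuity of the inclusion of [F] in [G]: the preimage of an open set is its trace on the
    smaller carrier. *)
Definition lc_incl F G : Prop :=
  carrier F `<=` carrier G /\
  forall A, opens G A -> opens F (A `&` carrier F).

(** Cofinality: every step of one family embeds continuously in a step of the other. Linearity of
    the inner unions allows a locally convex topology on the whole union to be traced on them. *)
Lemma indlim_indlim (I J K : Type) (D : set I) (E : set J) (P : set K)
    (F : I -> J -> lcspace V) (G : K -> lcspace V) :
  (forall i, D i ->
    (\bigcup_(j in E) carrier (F i j)) 0 /\
    forall (a : R) f g, (\bigcup_(j in E) carrier (F i j)) f ->
      (\bigcup_(j in E) carrier (F i j)) g ->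
      (\bigcup_(j in E) carrier (F i j)) (a *: f + g)) ->
  (forall k, P k -> exists i j, [/\ D i, E j & lc_incl (G k) (F i j)]) ->
  (forall i j, D i -> E j -> exists2 k, P k & lc_incl (F i j) (G k)) ->
  indlim D (fun i => indlim E (F i)) = indlim P G.
Proof.
move=> Flin GF FG; rewrite /indlim.
set C := \bigcup_(i in D) _; set C' := \bigcup_(k in P) _.
have CC' : C = C'.
  apply/seteqP; split => [f [i Di [j Ej Ff]]|f [k Pk Gf]].
    by have [k Pk [sub _]] := FG i j Di Ej; exists k => //; exact: sub.
  have [i [j [Di Ej [sub _]]]] := GF k Pk.
  by exists i => //; exists j => //; exact: sub.
rewrite -{}CC'; congr LCSpace; apply/seteqP; split.
- move=> O [T TO [lcT TF]]; exists T => //; split=> // k A Pk TA.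
  have [i [j [Di Ej [sub op]]]] := GF k Pk.
  have [T' T'A [_ T'F]] := TF i A Di TA.
  have := op _ (T'F j _ Ej T'A).
  rewrite -!setIA [X in _ `&` (_ `&` X)]setIC => H.
  suff -> : A `&` carrier (G k) = A `&` (carrier (indlim E (F i))
    `&` (carrier (G k) `&` carrier (F i j))) by [].
  apply/seteqP; split => [f [Af Gf]|f [Af [_ [Gf _]]]]; last by [].
  by split=> //; split; [exists j => //; exact: sub|split=> //; exact: sub].
(* The trace of [T] on the inner limit is the locally convex topology that witnesses openness
   there. *)
- move=> O [T TO [lcT TG]]; exists T => //; split=> // i A Di TA.
  have [F0 Fl] := Flin i Di.
  have sub : carrier (indlim E (F i)) `<=` C by move=> f Ff; exists i.
  exists [set B `&` carrier (indlim E (F i)) | B in T]; first by exists A.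
  split; first exact: is_lc_topology_trace lcT sub F0 Fl.
  move=> j _ Ej [B TB <-].
  have [k Pk [s op]] := FG i j Di Ej.
  have := op _ (TG k B Pk TB).
  suff -> : B `&` carrier (G k) `&` carrier (F i j) =
    B `&` carrier (indlim E (F i)) `&` carrier (F i j) by [].
  apply/seteqP; split => f [[Bf _] Ff]; split=> //; split=> //.
    by exists j.
  exact: s.
Qed.

Lemma smallest_topology C (S : set (set V)) : S `<=` [set O | O `<=` C] ->
  is_topology C (smallest (is_topology C) S).
Proof.
move=> SC; split.
(* Comparison with the discrete topology on [C]. *)
- move=> O; apply; split=> //; split=> //.
  + by move=> A B AC _ f [/AC].
  + by move=> Q QC f [A QA Af]; exact: QC QA _ Af.
- by move=> T [[]].
- move=> A B TA TB T [Tt ST]; case: (Tt) => _ _ + _; apply.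
    by apply: TA.
  by apply: TB.
- move=> Q QT T [Tt ST]; case: (Tt) => _ _ _; apply=> A QA.
  by apply: QT QA _ _.
Qed.

Lemma projlim_ext (V' : lmodType R) (I : Type) (D : set I)
    (pi : I -> V' -> V) (E : set V') (F G : I -> lcspace V) :
  (forall i, D i -> F i = G i) -> projlim E D pi F = projlim E D pi G.
Proof.
move=> FG; rewrite /projlim.
have -> : [set f | E f /\ forall i, D i -> carrier (F i) (pi i f)] =
    [set f | E f /\ forall i, D i -> carrier (G i) (pi i f)].
  apply/seteqP; split=> f [Ef H]; split=> // i Di; have := H i Di;
  by rewrite FG.
congr (LCSpace _ (smallest _ _)); apply/seteqP.
by split=> _ [i [A [Di iA ->]]]; exists i, A; split=> //; move: iA; rewrite FG.
Qed.

Lemma projlim_incl_topology (I : Type) (D : set I) (F : I -> lcspace V) :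
  is_topology (carrier (projlim_incl D F)) (opens (projlim_incl D F)).
Proof. by apply: smallest_topology => _ [i [A [_ _ ->]]] f []. Qed.

Lemma projlim_incl_open (I : Type) (D : set I) (F : I -> lcspace V) i A :
  D i -> opens (F i) A ->
  opens (projlim_incl D F) (carrier (projlim_incl D F) `&` A).
Proof. by move=> Di iA; apply: sub_gen_smallest; exists i, A. Qed.

Lemma projlim_incl_min (I : Type) (D : set I) (F : I -> lcspace V) T :
  is_topology (carrier (projlim_incl D F)) T ->
  (forall i A, D i -> opens (F i) A -> T (carrier (projlim_incl D F) `&` A)) ->
  opens (projlim_incl D F) `<=` T.
Proof.
by move=> tT TF; apply: smallest_sub => // _ [i [A [Di iA ->]]];
exact: (TF i A).
Qed.

Lemma eq_lcspace F G : carrier F = carrier G -> opens F = opens G -> F = G.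
Proof. by case: F => C T; case: G => C' T' /= -> ->. Qed.

(** Cofinality again; since both topologies are the coarsest possible, only generating open sets
    need to be compared. *)
Lemma projlim_projlim (I J K : Type) (D : set I) (E : set J) (P : set K)
    (F : I -> J -> lcspace V) (G : K -> lcspace V) :
  (forall k, P k -> exists i j, [/\ D i, E j & lc_incl (F i j) (G k)]) ->
  (forall i j, D i -> E j -> exists2 k, P k & lc_incl (G k) (F i j)) ->
  projlim_incl D (fun i => projlim_incl E (F i)) = projlim_incl P G.
Proof.
move=> FG GF; set L := projlim_incl D _; set L' := projlim_incl P G.
have LL' : carrier L = carrier L'.
  apply/seteqP; split => f [_ H]; split => //= k.
    by move=> Pk; have [i [j [Di Ej [s _]]]] := FG k Pk; apply/s/(H i Di).2.
  move=> Dk; split=> //= j Ej.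
  by have [l Pl [s _]] := GF k j Dk Ej; apply/s/H.
have LFi i : D i -> carrier L `<=` carrier (projlim_incl E (F i)).
  by move=> Di f [_ H]; exact: H.
apply: eq_lcspace => //; apply/seteqP; split.
- apply: projlim_incl_min => [|i A Di iA].
    by rewrite -/L LL'; exact: projlim_incl_topology.
  rewrite -/L.
  (* The finest topology on the inner limit for which the inclusion of [L'] is continuous; by
     minimality of the inner topology, only sets coming from some [F i j] remain to be checked. *)
  pose T := [set B | B `<=` carrier (projlim_incl E (F i)) /\
    opens L' (carrier L `&` B)].
  suff : T A by case.
  apply: (projlim_incl_min _ _ iA).
    have [_ t2 t3 t4] := projlim_incl_topology P G; split.
    + by move=> B [].
    + by split=> //; rewrite setIidl ?LL'//; rewrite -LL'; exact: LFi.
    + move=> B1 B2 [s1 o1] [s2 o2]; split; first by move=> f [/s1].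
      by rewrite -[carrier L]setIid setIACA; exact: t3.
    + move=> Q QT; split; first by move=> f [B /QT[BCi _] Bf]; exact: BCi.
      have -> : carrier L `&` \bigcup_(B in Q) B
          = \bigcup_(B in [set carrier L `&` B | B in Q]) B.
        rewrite setI_bigcupr; apply/seteqP; split => f.
          by move=> [B QB Bf]; exists (carrier L `&` B) => //; exists B.
        by move=> [_ [B QB <-] Bf]; exists B.
      by apply: t4 => _ [B /QT[_ ?] <-].
  move=> j B Ej jB; split; first by move=> f [].
  have [k Pk [s op]] := GF i j Di Ej.
  have := projlim_incl_open Pk (op _ jB).
  congr (opens L' _); rewrite -/L' -LL'; apply/seteqP; split => f [Cf].
    by move=> [Bf _]; do !split=> //; exact: (LFi i Di f Cf).2.
  move=> [_ Bf]; do !split=> //.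
  by move: Cf; rewrite LL' => -[_]; exact.
- apply: projlim_incl_min => [|k A Pk kA].
    by rewrite -/L' -LL'; exact: projlim_incl_topology.
  have [i [j [Di Ej [s op]]]] := FG k Pk.
  have oF := @projlim_incl_open _ E (F i) j _ Ej (op _ kA).
  have := @projlim_incl_open _ D (fun i => projlim_incl E (F i)) i _ Di oF.
  congr (opens L _); rewrite -/L' -LL'; apply/seteqP; split => f [Cf].
    by move=> [_ []].
  by have [_ H] := LFi i Di f Cf; do !split=> //; exact: H.
Qed.

Lemma normed_space_incl (E : set V) (N1 N2 : V -> \bar R) (c : R) : 0 < c ->
  (forall f, (N1 f <= c%:E * N2 f)%E) ->
  lc_incl (normed_space E N2) (normed_space E N1).
Proof.
move=> c0 N12.
have fin f : (N2 f < +oo)%E -> (N1 f < +oo)%E.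
  by move=> N2f; rewrite (le_lt_trans (N12 f))// lte_mul_pinfty// lee_fin ltW.
split=> [f [Ef /fin]|A [AC Aop]]; first by [].
split=> [f []//|f [Af [Ef N2f]]].
have [r r0 rA] := Aop f Af.
exists (r / c); first exact: divr_gt0.
move=> g [Eg N2g] gf; split=> //; apply: rA; first by split=> //; exact: fin.
by rewrite (le_lt_trans (N12 _))// muleC -lte_pdivlMr// .
Qed.

End LocallyConvexLimits.

(** * Asymptotics of the weights *)

(** The finitely many exceptions are absorbed by the sum of their differences. After exponentiation,
    [C] becomes the factor of a domination between weights. *)
Lemma near_le_bounded (R : realType) (u v : nat -> R) :
  (\forall n \near \oo, u n <= v n) ->
  exists2 C : R, 0 <= C & forall n, u n <= v n + C.
Proof.
move=> [N _ uv]; exists (\sum_(i < N) `|u i - v i|).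
  by apply: sumr_ge0.
move=> n; have [nN|/uv uvn] := ltnP n N; last first.
  by rewrite (le_trans uvn)// lerDl sumr_ge0.
rewrite -lerBlDl (le_trans (ler_norm _))//.
by rewrite (bigD1 (Ordinal nN))//= lerDl sumr_ge0.
Qed.

Lemma le_powR (R : realType) (p x y : R) :
  0 <= p -> 0 <= x -> x <= y -> x `^ p <= y `^ p.
Proof.
by move=> p0 x0 xy; apply: ge0_ler_powR; rewrite ?nnegrE ?(le_trans x0 xy).
Qed.

Section WeightAsymptotics.
Context {R : realType} {sigma : R} (sigma_gt1 : 1 < sigma).

(** Common scale for the logarithms of all weights, defined on reals since it is also evaluated at
    points such as [s / 2]. *)
Definition powln (x : R) : R := x `^ sigma * ln x.

Let sigma_gt0 : 0 < sigma. Proof. exact: lt_trans ltr01 _. Qed.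

Lemma powln_ge0 x : 1 <= x -> 0 <= powln x.
Proof. by move=> x1; rewrite mulr_ge0 ?powR_ge0 ?ln_ge0. Qed.

Lemma ler_powln x y : 1 <= x -> x <= y -> powln x <= powln y.
Proof.
move=> x1 xy; have x0 : 0 < x by rewrite (lt_le_trans ltr01).
have y0 : 0 < y by rewrite (lt_le_trans x0).
apply: ler_pM; rewrite ?powR_ge0 ?ln_ge0 ?ler_ln ?posrE//.
by rewrite le_powR// ltW.
Qed.

Lemma near_le_ln (A : R) : \forall n \near \oo, A <= ln n%:R.
Proof.
near=> n; have n1 : expR A <= n%:R by near: n; exact: nbhs_infty_ger.
by rewrite -ler_expR lnK// posrE (lt_le_trans (expR_gt0 A)).
Unshelve. all: by end_near. Qed.

Lemma near_le_powln (A : R) : \forall n \near \oo, A <= powln n%:R.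
Proof.
near=> n.
have n1 : 1 <= n%:R :> R by near: n; exact: nbhs_infty_ger.
have ln1 : 1 <= ln n%:R :> R by near: n; exact: near_le_ln.
have An : A <= n%:R by near: n; exact: nbhs_infty_ger.
apply: (le_trans An); rewrite -[leLHS]mulr1 ler_pM// ?(le_trans ler01)//.
by rewrite le1r_powR// ltW.
Unshelve. all: by end_near. Qed.

Lemma Mseq_gt0 h tau n : 0 < h -> 0 < Mseq sigma h tau n.
Proof.
move=> h0; rewrite /Mseq; case: n => [|n].
  by rewrite (powR0 (lt0r_neq0 sigma_gt0)) mulr0 !powRr0 mulr1.
by rewrite mulr_gt0 ?powR_gt0.
Qed.

Lemma ln_Mseq h tau n : 0 < h ->
  ln (Mseq sigma h tau n) = n%:R `^ sigma * (ln h + tau * ln n%:R).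
Proof.
move=> h0; case: n => [|n].
  rewrite /Mseq (powR0 (lt0r_neq0 sigma_gt0)) mulr0 !powRr0 mulr1.
  by rewrite ln1 mul0r.
by rewrite lnM ?posrE ?powR_gt0// !ln_powR; ring.
Qed.

(** As [n] is at most its power [sigma], the contributions of [c] and [h] lack the factor [ln n] and
    are eventually below half of the main term [tau * powln n]. *)
Lemma near_ln_Mseq c h tau : 0 < c -> 0 < h -> 0 < tau ->
  \forall n \near \oo,
    tau / 2 * powln n%:R <= ln (c ^+ n * Mseq sigma h tau n) <=
    2 * tau * powln n%:R.
Proof.
move=> c0 h0 t0; near=> n.
have n1 : 1 <= n%:R :> R by near: n; exact: nbhs_infty_ger.
have lnn : 2 / tau * (`|ln c| + `|ln h|) <= ln n%:R.
  by near: n; exact: near_le_ln.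
have nns : n%:R <= n%:R `^ sigma :> R by rewrite le1r_powR// ltW.
rewrite lnM ?posrE ?exprn_gt0 ?Mseq_gt0// lnXn// ln_Mseq// -(mulr_natl (ln c)).
have Bn : `|ln c| + `|ln h| <= tau / 2 * ln n%:R.
  by rewrite -ler_pdivrMl ?divr_gt0// invf_div.
have : `|n%:R * ln c + n%:R `^ sigma * ln h| <= tau / 2 * powln n%:R.
  rewrite (le_trans (ler_normD _ _))// !normrM normr_nat.
  rewrite (ger0_norm (powR_ge0 _ _)).
  rewrite (le_trans (_ : _ <= n%:R `^ sigma * (`|ln c| + `|ln h|)))//.
    by rewrite mulrDr lerD2r ler_wpM2r.
  by rewrite /powln mulrCA ler_wpM2l ?powR_ge0.
rewrite ler_norml => /andP[lo up].
have -> : n%:R * ln c + n%:R `^ sigma * (ln h + tau * ln n%:R) =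
   n%:R * ln c + n%:R `^ sigma * ln h + tau * powln n%:R.
  by rewrite /powln; ring.
have := mulr_ge0 (ltW t0) (powln_ge0 n1).
by move=> ?; apply/andP; split; lra.
Unshelve. all: by end_near. Qed.

(** The index is the least integer above [k * n], eventually at most [2 * (k * n)]. The power
    [sigma] of [k], divided by [k], leaves the exponent [sigma - 1]; [c] does not depend on [k]. *)
Lemma near_ln_Mseq_scale h tau : 0 < h -> 0 < tau ->
  exists2 c : R, 0 < c & forall k : R, 0 < k -> \forall n \near \oo,
    k^-1 * ln (Mseq sigma h tau (Num.truncn (k * n%:R)).+1) <=
    c * k `^ (sigma - 1) * powln n%:R.
Proof.
(* One factor 2 comes from [near_ln_Mseq], one from bounding the logarithm of [2 * (k * n)] by
   [2 * ln n], and the power of 2 from the bound on the index. *)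
move=> h0 t0; exists (4 * tau * 2 `^ sigma).
  by rewrite !mulr_gt0 ?powR_gt0.
move=> k k0; have [N _ MN] := near_ln_Mseq ltr01 h0 t0.
near=> n.
have n1 : 1 <= n%:R :> R by near: n; exact: nbhs_infty_ger.
have nk : 2 * k <= n%:R by near: n; exact: nbhs_infty_ger.
have knN : N%:R <= k * n%:R.
  by rewrite -ler_pdivrMl//; near: n; exact: nbhs_infty_ger.
have kn1 : 1 <= k * n%:R.
  by rewrite -ler_pdivrMl//; near: n; exact: nbhs_infty_ger.
set j := (Num.truncn _).+1.
have /andP[jlo jhi] : k * n%:R < j%:R <= 2 * (k * n%:R).
  rewrite truncnS_gt/=.
  have jE : j%:R = (Num.truncn (k * n%:R))%:R + 1 :> R by rewrite natr1.
  have : (Num.truncn (k * n%:R))%:R <= k * n%:R by rewrite truncn_le; lra.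
  by rewrite jE; lra.
have jN : (N <= j)%N by rewrite -(ler_nat R) ltW// (le_lt_trans knN).
have := MN j jN; rewrite expr1n mul1r => /andP[_ Mj].
rewrite -ler_pdivlMl ?invr_gt0// invrK (le_trans Mj)//.
have j1 : 1 <= j%:R :> R by rewrite ltW// (le_lt_trans kn1).
have : powln j%:R <= powln (2 * (k * n%:R)) by exact: ler_powln.
move/(ler_wpM2l (ltW (mulr_gt0 (ltr0Sn R 1) t0)))/le_trans; apply.
have n0 : 0 < n%:R :> R by lra.
have l2 : ln (2 * (k * n%:R)) <= 2 * ln n%:R.
  rewrite (mulr_natl (ln _)) -lnXn// ler_ln ?posrE ?mulr_gt0 ?exprn_gt0//.
  by rewrite mulrA expr2 ler_pM2r.
have -> : k * (4 * tau * 2 `^ sigma * k `^ (sigma - 1) * powln n%:R)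
   = 2 * tau * ((2 * (k * n%:R)) `^ sigma * (2 * ln n%:R)).
  rewrite !powRM ?mulr_ge0 ?ltW// -(mulr_powRB1 (ltW k0) sigma_gt0) /powln.
  by ring.
by rewrite ler_wpM2l ?mulr_ge0 ?(ltW t0)// ler_wpM2l// powR_ge0.
Unshelve. all: by end_near. Qed.

(** * The associated weight function and its Young conjugate *)

Section AssociatedWeight.
Variables (h tau : R) (h_gt0 : 0 < h) (tau_gt0 : 0 < tau).
Local Notation M := (Mseq sigma h tau).
Local Notation omega := (assoc_weight M).

Lemma near_ln_Mseq_ge : \forall n \near \oo, tau / 2 * powln n%:R <= ln (M n).
Proof.
have := near_ln_Mseq ltr01 h_gt0 tau_gt0; apply: filterS => n.
by rewrite expr1n mul1r => /andP[].
Qed.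

Lemma assoc_weight_expR t :
  omega (expR t) = sup (range (fun j : nat => j%:R * t - ln (M j))).
Proof.
rewrite /assoc_weight expR_gt0; congr (sup (_ @` _)); apply/funext => j.
rewrite lnM ?posrE ?exprn_gt0 ?expR_gt0 ?invr_gt0 ?Mseq_gt0//.
by rewrite lnV ?posrE ?Mseq_gt0// lnXn ?expR_gt0// expRK mulr_natl.
Qed.

(** The real supremum is meaningful only for bounded sets. Here [ln (M n)] eventually exceeds the
    linear term [n * t]. *)
Lemma assoc_weight_has_ubound t :
  has_ubound (range (fun j : nat => j%:R * t - ln (M j))).
Proof.
suff : \forall n \near \oo, n%:R * t - ln (M n) <= 0.
  move/(@near_le_bounded _ _ (fun=> 0))=> [C _ HC]; exists C => _ [j _ <-].
  by rewrite -[C]add0r.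
near=> n.
have n1 : 1 <= n%:R :> R by near: n; exact: nbhs_infty_ger.
have lnn : 2 / tau * `|t| <= ln n%:R by near: n; exact: near_le_ln.
have lnM : tau / 2 * powln n%:R <= ln (M n).
  by near: n; exact: near_ln_Mseq_ge.
rewrite subr_le0 (le_trans _ lnM)// /powln mulrCA.
apply: (@le_trans _ _ (n%:R * (tau / 2 * ln n%:R))).
  rewrite ler_wpM2l// -ler_pdivrMl ?divr_gt0// invf_div (le_trans _ lnn)//.
  by rewrite ler_wpM2l ?ler_norm// divr_ge0 ?(ltW tau_gt0).
rewrite ler_wpM2r ?mulr_ge0 ?ln_ge0 ?(ltW tau_gt0)//.
by rewrite le1r_powR// ltW.
Unshelve. all: by end_near. Qed.

Lemma le_assoc_weight t j : j%:R * t - ln (M j) <= omega (expR t).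
Proof.
by rewrite assoc_weight_expR; apply: ub_le_sup;
  [exact: assoc_weight_has_ubound|exists j].
Qed.

Lemma assoc_weight_le t (B : R) :
  (forall j, j%:R * t - ln (M j) <= B) -> omega (expR t) <= B.
Proof.
move=> HB; rewrite assoc_weight_expR; apply: ge_sup.
  by exists (0%:R * t - ln (M 0)); exists 0.
by move=> _ [j _ <-].
Qed.

(** Bound [omega] from below by its term of index [j], then use [s <= j] and [t >= 0]. This also
    shows that the supremum defining the conjugate is finite. *)
Lemma young_ub s j : s <= j%:R ->
  ubound [set s * t - phi omega t | t in [set t | 0 <= t]] (ln (M j)).
Proof.
move=> sj _ [t /= t0 <-]; rewrite lerBlDr -lerBlDl.
rewrite (le_trans _ (le_assoc_weight t j))//.
by rewrite lerB// ler_wpM2r.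
Qed.

Lemma young_le s j : s <= j%:R -> young omega s <= ln (M j).
Proof.
move=> sj; apply: ge_sup (young_ub sj).
by exists (s * 0 - phi omega 0); exists 0 => /=.
Qed.

Lemma le_young s t : 0 <= t -> s * t - omega (expR t) <= young omega s.
Proof.
move=> t0; apply: ub_le_sup; last by exists t.
by exists (ln (M (Num.truncn s).+1)); apply: young_ub; rewrite ltW// truncnS_gt.
Qed.

(* The supremum defining [young omega s] is bounded from below by its value at
   [t = tau / 2 * (s / 2) ^ (sigma - 1) * ln (s / 2)]: for this [t] the terms
   [j t - ln (M j)] with [j >= s / 2] are bounded, so that
   [omega (expR t) <= s t / 2 + O(1)]. *)
Lemma young_ge : exists2 C : R, 0 <= C & forall s : R, 2 <= s ->
  tau / 2 * powln (s / 2) - C <= young omega s.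
Proof.
have [C C0 HC] := near_le_bounded near_ln_Mseq_ge.
exists C => // s s2; pose t := tau / 2 * ((s / 2) `^ (sigma - 1) * ln (s / 2)).
have s1 : 1 <= s / 2 by lra.
have t0 : 0 <= t by rewrite !mulr_ge0 ?powR_ge0 ?ln_ge0 ?(ltW tau_gt0).
apply: le_trans (le_young s t0).
have st : tau / 2 * powln (s / 2) = s / 2 * t.
  rewrite /t /powln -(mulr_powRB1 _ sigma_gt0) ?(le_trans ler01)//.
  by ring.
rewrite st.
suff : omega (expR t) <= s / 2 * t + C by lra.
apply: assoc_weight_le => j; rewrite lerBlDr.
have [js|sj] := leP j%:R (s / 2).
  have Mj : 0 <= ln (M j) + C.
    apply: le_trans (HC j); rewrite mulr_ge0 ?divr_ge0 ?(ltW tau_gt0)//.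
    (* Index 0 is apart, as [powln_ge0] needs an argument at least 1; there [powln] vanishes. *)
    case: (j) => [|i]; last by rewrite powln_ge0// ler1n.
    by rewrite /powln powR0 ?mul0r// lt0r_neq0.
  have : j%:R * t <= s / 2 * t by rewrite ler_wpM2r.
  by lra.
have jt : j%:R * t <= tau / 2 * powln j%:R.
  rewrite /powln -(mulr_powRB1 _ sigma_gt0)// /t.
  rewrite -(mulrA j%:R) [leRHS]mulrCA ler_wpM2l//.
  rewrite ler_wpM2l ?divr_ge0 ?(ltW tau_gt0)//.
  apply: ler_pM; rewrite ?powR_ge0 ?ln_ge0//.
    by rewrite le_powR ?subr_ge0 ?(le_trans ler01 s1)// ltW.
  by rewrite ler_ln ?posrE; lra.
have := HC j; have := mulr_ge0 (le_trans ler01 s1) t0; lra.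
Qed.

(** The upper bound is [young_le] at the least integer above [k * n], the lower one [young_ge] at
    [s = k * n]. The constants are uniform in [k]; only the threshold for [n] varies. *)
Lemma near_young : exists c1 c2 : R, [/\ 0 < c1, 0 < c2 &
  forall k : R, 0 < k -> \forall n \near \oo,
    c1 * k `^ (sigma - 1) * powln n%:R <= k^-1 * young omega (k * n%:R) <=
    c2 * k `^ (sigma - 1) * powln n%:R].
Proof.
have [c2 c20 Hc2] := near_ln_Mseq_scale h_gt0 tau_gt0.
have [C C0 HC] := young_ge.
(* Starting from [tau / 2], one half is lost by replacing [ln (k * n / 2)] with [ln n / 2] and
   another in absorbing [C]; the power of 2 comes from [s / 2]. *)
pose c1 := tau / 8 * 2 `^ (- sigma).
exists c1, c2; split => //; first by rewrite mulr_gt0 ?divr_gt0 ?powR_gt0.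
move=> k k0; near=> n; apply/andP; split; last first.
  apply: (@le_trans _ _ (k^-1 * ln (M (Num.truncn (k * n%:R)).+1))).
    by rewrite ler_wpM2l ?invr_ge0 ?(ltW k0)// young_le// ltW// truncnS_gt.
  by near: n; exact: Hc2.
have n1 : 1 <= n%:R :> R by near: n; exact: nbhs_infty_ger.
have kn2 : 2 <= k * n%:R.
  by rewrite -ler_pdivrMl//; near: n; exact: nbhs_infty_ger.
have lnn : - (2 * ln (k / 2)) <= ln n%:R by near: n; exact: near_le_ln.
rewrite -ler_pdivrMl ?invr_gt0// invrK.
apply: le_trans (HC _ kn2).
have d0 : 0 < tau / 8 * (k / 2) `^ sigma.
  by rewrite mulr_gt0 ?divr_gt0 ?powR_gt0 ?divr_gt0.
have LC : C / (tau / 8 * (k / 2) `^ sigma) <= powln n%:R.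
  by near: n; exact: near_le_powln.
rewrite ler_pdivrMr// in LC.
have -> : k * (c1 * k `^ (sigma - 1) * powln n%:R) =
    powln n%:R * (tau / 8 * (k / 2) `^ sigma).
  rewrite (powRM _ (ltW k0)) ?invr_ge0// -[2^-1]powR_inv1// -powRrM mulN1r.
  by rewrite -(mulr_powRB1 (ltW k0) sigma_gt0) /c1; ring.
suff : 2 * (powln n%:R * (tau / 8 * (k / 2) `^ sigma)) <=
    tau / 2 * powln (k * n%:R / 2) by lra.
have -> : k * n%:R / 2 = k / 2 * n%:R by ring.
rewrite /powln (@powRM _ (k / 2)) ?divr_ge0 ?(ltW k0)//.
rewrite (@lnM _ (k / 2)) ?posrE ?divr_gt0 ?(lt_le_trans ltr01 n1)//.
have -> : 2 * (n%:R `^ sigma * ln n%:R * (tau / 8 * (k / 2) `^ sigma)) =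
   tau / 2 * ((k / 2) `^ sigma * n%:R `^ sigma * (ln n%:R / 2)) by field.
rewrite ler_wpM2l ?divr_ge0 ?(ltW tau_gt0)//.
rewrite ler_wpM2l ?mulr_ge0 ?powR_ge0//.
by lra.
Unshelve. all: by end_near. Qed.

End AssociatedWeight.

(** Each term [j * t - ln (M j)] is compared with [k^-1] times the term of [M'] whose index lies
    just above [k * j]. *)
Lemma assoc_weight_bigO h tau h' tau' :
  0 < h -> 0 < h' -> 0 < tau -> 0 < tau' ->
  bigO_infty (assoc_weight (Mseq sigma h tau))
             (assoc_weight (Mseq sigma h' tau')).
Proof.
move=> h0 h'0 t0 t'0.
set M := Mseq sigma h tau; set M' := Mseq sigma h' tau'.
have [c c0 Hc] := near_ln_Mseq_scale h'0 t'0.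
(* Solves [c * k ^ (sigma - 1) = tau / 2], so that the rescaled [ln M'] stays below the lower bound
   for [ln M]. *)
pose k := (tau / 2 / c) `^ (sigma - 1)^-1.
have k0 : 0 < k by rewrite powR_gt0// !divr_gt0.
have ck : c * k `^ (sigma - 1) = tau / 2.
  rewrite -powRrM mulVf ?subr_eq0 ?gt_eqF// powRr1 ?ltW ?divr_gt0//.
  by rewrite mulrC divfK ?gt_eqF.
have : \forall n \near \oo,
    k^-1 * ln (M' (Num.truncn (k * n%:R)).+1) <= ln (M n).
  near=> n; apply: (@le_trans _ _ (tau / 2 * powln n%:R)).
    by rewrite -ck; near: n; exact: Hc.
  by near: n; exact: near_ln_Mseq_ge.
move/near_le_bounded => [C C0 HC].
exists (k^-1 + 1); first by rewrite addr_gt0 ?invr_gt0.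
near=> x.
have x1 : 1 <= x by near: x; exact: nbhs_pinfty_ge.
have xC : expR (C + ln (M' 1)) <= x by near: x; exact: nbhs_pinfty_ge.
have x0 : 0 < x by rewrite (lt_le_trans ltr01).
rewrite -[x]lnK ?posrE//; set t := ln x.
have t0' : 0 <= t by exact: ln_ge0.
have tC : C + ln (M' 1) <= t by rewrite -ler_expR lnK.
(* The term of index 1 makes the second weight exceed [C] for large [t]; this accounts for the [+ 1]
   in the constant. *)
have wC : C <= assoc_weight M' (expR t).
  by apply: le_trans (le_assoc_weight h'0 t'0 t 1); rewrite -/M'; lra.
have w0 : 0 <= assoc_weight M (expR t).
  apply: le_trans (le_assoc_weight h0 t0 t 0).
  by rewrite ln_Mseq// powR0 ?mul0r ?subrr ?gt_eqF.
rewrite (ger0_norm w0) ger0_norm ?(le_trans C0)//.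
suff : assoc_weight M (expR t) <= k^-1 * assoc_weight M' (expR t) + C by lra.
apply: assoc_weight_le => // j.
set i := (Num.truncn (k * j%:R)).+1.
have := le_assoc_weight h'0 t'0 t i; rewrite -/M' => Hi.
have ki0 : 0 <= k^-1 by rewrite invr_ge0 ltW.
have := ler_wpM2l ki0 Hi; rewrite mulrBr.
have := HC j; rewrite -/i.
have : j%:R * t <= k^-1 * (i%:R * t).
  by rewrite mulrA ler_wpM2r// ler_pdivlMl// ltW// truncnS_gt.
by rewrite -/M; lra.
Unshelve. all: by end_near. Qed.

End WeightAsymptotics.

Arguments powln {R} sigma x.

(** * Spaces of ultradifferentiable functions *)

Section SmoothCompact.
Context {R : realType} {d : nat} {W : completeNormedModType R}.
Implicit Types (f g : 'rV[R]_d -> W) (K U : set 'rV[R]_d) (a : R).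

Section Open.
Variables (U : set 'rV[R]_d) (U_open : open U) (f g : 'rV[R]_d -> W) (a : R).
Hypotheses (f_smooth : smooth_on U f) (g_smooth : smooth_on U g).

Lemma partials_linear s x : U x ->
  partials s (a *: f + g) x = a *: partials s f x + partials s g x.
Proof.
elim: s x => [//|i s IHs] x Ux /=.
have [_ /(_ i) df] := f_smooth s Ux; have [_ /(_ i) dg] := g_smooth s Ux.
rewrite (@near_eq_derive _ _ _ _ (a \*: partials s f + partials s g)).
  by rewrite deriveD ?deriveZ//; exact: derivableZ.
by apply: filterS (open_nbhs_nbhs (conj U_open Ux)) => y Uy; rewrite IHs.
Qed.

Lemma smooth_on_linear : smooth_on U (a *: f + g).
Proof.
move=> s x Ux; have [cf df] := f_smooth s Ux; have [cg dg] := g_smooth s Ux.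
have near_eq : {near x, a \*: partials s f + partials s g =1
    partials s (a *: f + g)}.
  apply: filterS (open_nbhs_nbhs (conj U_open Ux)) => y Uy.
  by rewrite partials_linear.
split=> [|i].
  rewrite /prop_for /continuous_at partials_linear//.
  apply: cvg_trans (near_eq_cvg near_eq) _.
  by apply: cvgD cg; exact: cvgZl_tmp.
apply: near_eq_derivable near_eq _.
by apply: derivableD => //; exact: derivableZ.
Qed.

End Open.

Section Compact.
Variables (K : set 'rV[R]_d) (K_reg : closure K^° = K).

Lemma cvg_mderiv_linear f g a alpha x :
  smooth_compact K f -> smooth_compact K g -> K x ->
  mderiv alpha (a *: f + g) y @[y --> within K^° (nbhs x)] -->
    a *: mderivK K alpha f x + mderivK K alpha g x.
Proof.
move=> [_ _ fs fc] [_ _ gs gc] Kx.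
have near_eq : {near within K^° (nbhs x),
    a \*: mderiv alpha f + mderiv alpha g =1 mderiv alpha (a *: f + g)}.
  have : within K^° (nbhs x) K^° by exact: withinT.
  apply: filterS => y Ky; apply/esym.
  by apply: (partials_linear (@open_interior _ K)).
apply: cvg_trans (near_eq_cvg near_eq) _.
by apply: cvgD; [apply: cvgZl_tmp; exact: fc|exact: gc].
Qed.

Lemma mderivK_linear f g a alpha x : smooth_compact K f -> smooth_compact K g ->
  K x ->
  mderivK K alpha (a *: f + g) x =
    a *: mderivK K alpha f x + mderivK K alpha g x.
Proof.
move=> fs gs Kx.
(* Points of [K] adhere to its interior, so the filter is proper and limits are unique. *)
have : closure K^° x by rewrite K_reg.
move=> /within_nbhs_proper PF.
by apply: cvg_lim => //; exact: cvg_mderiv_linear.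
Qed.

Lemma smooth_compact_linear f g a : smooth_compact K f -> smooth_compact K g ->
  smooth_compact K (a *: f + g).
Proof.
move=> fs gs; case: (fs) (gs) => f0 fc fsm fl [g0 gc gsm gl]; split.
- by move=> x Kx; rewrite !fctE f0// g0// scaler0 addr0.
- by move=> x; apply: cvgD; [apply: cvgZl_tmp; exact: fc|exact: gc].
- by apply: smooth_on_linear => //; exact: open_interior.
- by move=> alpha x Kx; apply/cvg_ex; eexists; exact: cvg_mderiv_linear.
Qed.

Lemma partials0 s : partials s (0 : 'rV[R]_d -> W) = 0.
Proof.
elim: s => [//|i s IHs] /=; rewrite IHs; apply/funext => x.
exact: derive_cst.
Qed.

Lemma smooth_compact0 : smooth_compact K (0 : 'rV[R]_d -> W).
Proof.
split=> //.
- by move=> x; exact: cvg_cst.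
- move=> s x _; rewrite partials0; split.
    exact: (@cst_continuous _ _ (0 : W)).
  by move=> i; exact: derivable_cst.
- move=> alpha x _; rewrite /mderiv partials0.
  by apply/cvg_ex; exists 0; exact: cvg_cst.
Qed.

Variable w : nat -> R.
Hypothesis w_gt0 : forall n, 0 < w n.

Lemma weighted_norm_ltyP f :
  (weighted_norm w K f < +oo)%E <-> exists B : R, forall alpha x, K x ->
    `|mderivK K alpha f x| / w (mdeg alpha) <= B.
Proof.
split=> [fin|[B HB]].
  have [B NB] : exists B : R, (weighted_norm w K f <= B%:E)%E.
    case: weighted_norm fin => [r| |]// _; first by exists r.
    (* The value [-oo] is the supremum over an empty [K]. *)
    by exists 0; rewrite leNye.
  exists B => alpha x Kx; rewrite -lee_fin; apply: le_trans NB.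
  by apply: ereal_sup_ubound; exists alpha => //; exists x.
apply: le_lt_trans (ltry B); apply: ge_ereal_sup => _ [alpha _ [x Kx <-]].
by rewrite lee_fin HB.
Qed.

Lemma carrier_ultraK0 : carrier (ultraK w K) (0 : 'rV[R]_d -> W).
Proof.
split; first exact: smooth_compact0.
apply/weighted_norm_ltyP; exists 0 => alpha x Kx.
(* With this form of 0, linearity makes the extended derivative cancel. *)
have -> : (0 : 'rV[R]_d -> W) = -1 *: 0 + 0 by rewrite scaler0 addr0.
rewrite mderivK_linear//; last 2 first.
- exact: smooth_compact0.
- exact: smooth_compact0.
by rewrite scaleN1r addNr normr0 mul0r.
Qed.

Lemma carrier_ultraK_linear f g a : carrier (ultraK w K) f ->
  carrier (ultraK w K) g -> carrier (ultraK w K) (a *: f + g).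
Proof.
move=> [fs /weighted_norm_ltyP[B HB]] [gs /weighted_norm_ltyP[B' HB']].
split; first exact: smooth_compact_linear.
apply/weighted_norm_ltyP; exists (`|a| * B + B') => alpha x Kx.
rewrite mderivK_linear//.
apply: le_trans (_ : (`|a| * `|mderivK K alpha f x| +
    `|mderivK K alpha g x|) / w (mdeg alpha) <= _).
  rewrite ler_pM2r ?invr_gt0//.
  by rewrite (le_trans (ler_normD _ _))// normrZ.
by rewrite mulrDl -mulrA lerD ?HB'// ler_wpM2l ?HB.
Qed.

End Compact.

Definition dominated (u v : nat -> R) : Prop :=
  exists2 c : R, 0 < c & forall n, u n <= c * v n.

Lemma ultraK_incl (u v : nat -> R) K : (forall n, 0 < u n) ->
  (forall n, 0 < v n) -> dominated u v ->
  lc_incl (ultraK u K : lcspace ('rV[R]_d -> W)) (ultraK v K).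
Proof.
move=> u0 v0 [c c0 uv]; apply: (normed_space_incl _ c0) => f.
apply: ge_ereal_sup => _ [alpha _ [x Kx <-]].
apply: (@le_trans _ _ (c%:E * (`|mderivK K alpha f x| / u (mdeg alpha))%:E)%E).
  rewrite -EFinM lee_fin mulrCA ler_wpM2l//.
  by rewrite -[leLHS]mul1r ler_pdivrMr// mulrAC ler_pdivlMr// mul1r.
rewrite lee_wpmul2l ?lee_fin ?(ltW c0)//.
by apply: ereal_sup_ubound; exists alpha => //; exists x.
Qed.

End SmoothCompact.

Lemma near_ln_dominated (R : realType) (u v : nat -> R) :
  (forall n, 0 < u n) -> (forall n, 0 < v n) ->
  (\forall n \near \oo, ln (u n) <= ln (v n)) -> dominated u v.
Proof.
move=> u0 v0 /near_le_bounded[C C0 HC]; exists (expR C); first exact: expR_gt0.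
move=> n; rewrite -[u n]lnK ?posrE// -[v n]lnK ?posrE// -expRD ler_expR addrC.
exact: HC.
Qed.

(** * Mutual absorption of the two families of weights *)

Section MatrixVersusWeight.
Context {R : realType} {d : nat} {W : completeNormedModType R}.
Variables (sigma h tau : R) (sigma_gt1 : 1 < sigma).
Variables (h_gt0 : 0 < h) (tau_gt0 : 0 < tau).
Local Notation omega := (assoc_weight (Mseq sigma h tau)).

Let wseq (x k : R) (n : nat) : R := k ^+ n * Mmatrix sigma x n.
Let womega (k : R) (n : nat) : R := expR (k^-1 * young omega (k * n%:R)).

Let wseq_gt0 x k n : 0 < x -> 0 < k -> 0 < wseq x k n.
Proof. by move=> x0 k0; rewrite mulr_gt0 ?exprn_gt0// Mseq_gt0. Qed.

Let womega_gt0 k n : 0 < womega k n. Proof. exact: expR_gt0. Qed.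

(** Both logarithms are comparable to [powln], with coefficients of order [x] and [y ^ (sigma - 1)],
    so domination reduces to comparing these coefficients. *)
Let near_womega : exists c1 c2 : R, [/\ 0 < c1, 0 < c2 &
  forall x y k : R, 0 < x -> 0 < y -> 0 < k ->
    (2 * x <= c1 * y `^ (sigma - 1) -> dominated (wseq x k) (womega y)) /\
    (c2 * y `^ (sigma - 1) <= x / 2 -> dominated (womega y) (wseq x k))].
Proof.
have [c1 [c2 [c10 c20 Hc]]] := near_young sigma_gt1 h_gt0 tau_gt0.
exists c1, c2; split=> // x y k x0 y0 k0; split=> xy.
- apply: near_ln_dominated => [n|n|]; [exact: wseq_gt0|exact: womega_gt0|].
  near=> n.
  have n1 : 1 <= n%:R :> R by near: n; exact: nbhs_infty_ger.
  have /andP[_ +] : x / 2 * powln sigma n%:R <= ln (wseq x k n) <=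
      2 * x * powln sigma n%:R by near: n; exact: near_ln_Mseq.
  move/le_trans; apply; rewrite expRK.
  have /andP[+ _] : c1 * y `^ (sigma - 1) * powln sigma n%:R <=
      y^-1 * young omega (y * n%:R) <=
      c2 * y `^ (sigma - 1) * powln sigma n%:R by near: n; exact: Hc.
  by apply: le_trans; rewrite ler_wpM2r// powln_ge0.
- apply: near_ln_dominated => [n|n|]; [exact: womega_gt0|exact: wseq_gt0|].
  near=> n.
  have n1 : 1 <= n%:R :> R by near: n; exact: nbhs_infty_ger.
  have /andP[+ _] : x / 2 * powln sigma n%:R <= ln (wseq x k n) <=
      2 * x * powln sigma n%:R by near: n; exact: near_ln_Mseq.
  apply: le_trans; rewrite expRK.
  have /andP[_ +] : c1 * y `^ (sigma - 1) * powln sigma n%:R <=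
      y^-1 * young omega (y * n%:R) <=
      c2 * y `^ (sigma - 1) * powln sigma n%:R by near: n; exact: Hc.
  by move/le_trans; apply; rewrite ler_wpM2r// powln_ge0.
Unshelve. all: by end_near. Qed.

Let root_sigma (b : R) : 0 < b -> exists2 y : R, 0 < y & y `^ (sigma - 1) = b.
Proof.
move=> b0; exists (b `^ (sigma - 1)^-1); first exact: powR_gt0.
by rewrite -powRrM mulVf ?powRr1 ?(ltW b0)// subr_eq0 gt_eqF.
Qed.

(** The Roumieu case needs a larger weight in the other family ([womega_wseq], [wseq_womega]), the
    Beurling case a smaller one ([wseq_womega_small], [womega_small_wseq]). *)
Let womega_wseq y : 0 < y -> exists2 x, 0 < x & dominated (womega y) (wseq x 1).
Proof.
have [c1 [c2 [c10 c20 Hc]]] := near_womega; move=> y0.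
have x0 : 0 < 2 * (c2 * y `^ (sigma - 1)) by rewrite !mulr_gt0 ?powR_gt0.
exists (2 * (c2 * y `^ (sigma - 1))) => //.
by apply: (Hc _ _ _ x0 y0 ltr01).2; lra.
Qed.

Let wseq_womega_small y :
  0 < y -> exists2 x, 0 < x & dominated (wseq x 1) (womega y).
Proof.
have [c1 [c2 [c10 c20 Hc]]] := near_womega; move=> y0.
have x0 : 0 < c1 * y `^ (sigma - 1) / 2 by rewrite !mulr_gt0 ?powR_gt0.
exists (c1 * y `^ (sigma - 1) / 2) => //.
by apply: (Hc _ _ _ x0 y0 ltr01).1; lra.
Qed.

Let wseq_womega x k : 0 < x -> 0 < k ->
  exists2 y, 0 < y & dominated (wseq x k) (womega y).
Proof.
have [c1 [c2 [c10 c20 Hc]]] := near_womega; move=> x0 k0.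
have [y y0 yE] := root_sigma (divr_gt0 (mulr_gt0 (ltr0Sn R 1) x0) c10).
by exists y => //; apply: (Hc _ _ _ x0 y0 k0).1;
  rewrite yE [leRHS]mulrC divfK ?gt_eqF.
Qed.

Let womega_small_wseq x k : 0 < x -> 0 < k ->
  exists2 y, 0 < y & dominated (womega y) (wseq x k).
Proof.
have [c1 [c2 [c10 c20 Hc]]] := near_womega; move=> x0 k0.
have [y y0 yE] := root_sigma (divr_gt0 (divr_gt0 x0 (ltr0Sn R 1)) c20).
by exists y => //; apply: (Hc _ _ _ x0 y0 k0).2;
  rewrite yE [leLHS]mulrC divfK ?gt_eqF.
Qed.

Lemma Roumieu_matrix_omega (U : set 'rV[R]_d) :
  Roumieu_matrix W (Mmatrix sigma) U = Roumieu_omega W omega U.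
Proof.
apply: projlim_ext => K [[_ _ regK _] _]; apply: indlim_indlim.
- move=> x /= x0; split.
    by exists 1 => /=; [exact: ltr01|apply: carrier_ultraK0].
  (* Since the weights increase with [k], both functions lie in the step of index
     [Num.max k1 k2]. *)
  move=> a f g [k1 k10 fk1] [k2 k20 gk2].
  have k0 : 0 < Num.max k1 k2 by rewrite lt_max k10.
  have dom k : 0 < k -> k <= Num.max k1 k2 ->
      dominated (wseq x k) (wseq x (Num.max k1 k2)).
    move=> k_gt0 kk; exists 1 => // n; rewrite mul1r.
    rewrite ler_wpM2r ?(ltW (Mseq_gt0 _ _ _ _))//.
    by apply: lerXn2r => //; rewrite nnegrE ltW.
  exists (Num.max k1 k2) => //; apply: carrier_ultraK_linear => //.
  + by move=> n; exact: wseq_gt0.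
  + apply: (ultraK_incl _ _ _ (dom k1 _ _)).1 fk1 => // [n|n|].
    * exact: wseq_gt0.
    * exact: wseq_gt0.
    * by rewrite le_max lexx.
  + apply: (ultraK_incl _ _ _ (dom k2 _ _)).1 gk2 => // [n|n|].
    * exact: wseq_gt0.
    * exact: wseq_gt0.
    * by rewrite le_max lexx orbT.
- move=> y /= y0; have [x x0 xy] := womega_wseq y0.
  exists x, 1; split=> //; first exact: ltr01.
  by apply: ultraK_incl xy => n; [exact: womega_gt0|exact: wseq_gt0].
- move=> x k /= x0 k0; have [y y0 xy] := wseq_womega x0 k0.
  exists y => //.
  by apply: ultraK_incl xy => n; [exact: wseq_gt0|exact: womega_gt0].
Qed.

Lemma Beurling_matrix_omega (U : set 'rV[R]_d) :
  Beurling_matrix W (Mmatrix sigma) U = Beurling_omega W omega U.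
Proof.
apply: projlim_ext => K _; apply: projlim_projlim.
- move=> y /= y0; have [x x0 xy] := wseq_womega_small y0.
  exists x, 1; split=> //; first exact: ltr01.
  by apply: ultraK_incl xy => n; [exact: wseq_gt0|exact: womega_gt0].
- move=> x k /= x0 k0; have [y y0 xy] := womega_small_wseq x0 k0.
  exists y => //.
  by apply: ultraK_incl xy => n; [exact: womega_gt0|exact: wseq_gt0].
Qed.

End MatrixVersusWeight.

Theorem theorem6p8 (R : realType) (d : nat) (W : completeNormedModType R)
    (sigma : R) (sigma_gt1 : 1 < sigma) :
  [/\ forall U : set 'rV[R]_d, open U -> U !=set0 ->
        Roumieu_matrix W (Mmatrix sigma) U
          = Roumieu_omega W (omega_sigma sigma) U /\
        Beurling_matrix W (Mmatrix sigma) U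
          = Beurling_omega W (omega_sigma sigma) U,
      forall h h' tau tau' : R, 0 < h -> 0 < h' -> 0 < tau -> 0 < tau' ->
        weight_equiv (assoc_weight (Mseq sigma h tau))
                     (assoc_weight (Mseq sigma h' tau')) &
      forall (h tau : R) (U : set 'rV[R]_d), 0 < h -> 0 < tau ->
        open U -> U !=set0 ->
        Roumieu_matrix W (Mmatrix sigma) U
          = Roumieu_omega W (assoc_weight (Mseq sigma h tau)) U /\
        Beurling_matrix W (Mmatrix sigma) U
          = Beurling_omega W (assoc_weight (Mseq sigma h tau)) U].
Proof.
split.
(* [omega_sigma] is the case [h = tau = 1] of the general comparison. *)
- move=> U _ _; rewrite /omega_sigma; split.
    by apply: Roumieu_matrix_omega.
  by apply: Beurling_matrix_omega.
- by move=> h h' tau tau' h0 h'0 t0 t'0; split; exact: assoc_weight_bigO.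
- move=> h tau U h0 t0 _ _; split; first exact: Roumieu_matrix_omega.
  exact: Beurling_matrix_omega.
Qed.
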